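(* Let $(G,\mathcal{P})$ and $(H,\mathcal{Q})$ be group pairs and let $n\in\mathbb{N}$ with $n\ge 2$. If $(G,\mathcal{P})$ is a quasi-retract of $(H,\mathcal{Q})$ and $(H,\mathcal{Q})$ is of type $\mathsf{FP}_n$, then $(G,\mathcal{P})$ is of type $\mathsf{FP}_n$.
   Context: A group pair $(G,\mathcal{P})$ consists of a finitely generated group $G$ and a non-empty finite collection $\mathcal{P}$ of subgroups of $G$ (repetitions allowed). $G/\mathcal{P}$ denotes the $G$-set $\coprod_{P\in\mathcal{P}}G/P$, also viewed as the collection of cosets $gP$ ($P\in\mathcal{P}$), each coset regarded as a subset of $G$. Let $\mathbb{Z}[G/\mathcal{P}]=\bigoplus_{P\in\mathcal{P}}\bigoplus_{gP\in G/P}\mathbb{Z}$ be the permutation $\mathbb{Z}G$-module, $\varepsilon\colon\mathbb{Z}[G/\mathcal{P}]\to\mathbb{Z}$ the augmentation that is the identity on each summand, and $\Delta_{G/\mathcal{P}}=\ker(\varepsilon)$. For $n\ge1$, $(G,\mathcal{P})$ is of type $\mathsf{FP}_n$ if there is a projective $\mathbb{Z}G$-resolution $\cdots\to P_1\to P_0\to\Delta_{G/\mathcal{P}}\to0$ with $P_i$ finitely generated for $i=0,\dots,n-1$. Finitely generated groups are equipped with word metrics for some finite generating sets. A map $f\colon X\to Y$ of metric spaces is $(L,C)$-Lipschitz if $d_Y(f(x),f(x'))\le L\,d_X(x,x')+C$ for all $x,x'$. For group pairs $(G,\mathcal{P}),(H,\mathcal{Q})$ and $L\ge1$, $C\ge0$,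 $M\ge0$, an $(L,C,M)$-Lipschitz map of pairs $f=(f_1,f_2)\colon(G,\mathcal{P})\to(H,\mathcal{Q})$ consists of an $(L,C)$-Lipschitz map $f_1\colon G\to H$ and a function $f_2\colon G/\mathcal{P}\to H/\mathcal{Q}$ such that the Hausdorff distance in $H$ between $f_1(A)$ and $f_2(A)$ is $<M$ for every $A\in G/\mathcal{P}$. An $(L,C,M)$-quasi-retraction of pairs $(f,r)$ consists of $(L,C,M)$-Lipschitz maps of pairs $f\colon(G,\mathcal{P})\to(H,\mathcal{Q})$ and $r\colon(H,\mathcal{Q})\to(G,\mathcal{P})$ such that $d_G(r_1(f_1(g)),g)\le C$ for all $g\in G$ and $r_2\circ f_2=\mathrm{id}_{G/\mathcal{P}}$. $(G,\mathcal{P})$ is a quasi-retract of $(H,\mathcal{Q})$ if such a quasi-retraction exists for some $L\ge1,C\ge0,M\ge0$. *)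

(* Defs.v *)
From HB Require Import structures.
From mathcomp Require Import all_boot all_order all_algebra.
From Stdlib Require List.
Set Implicit Arguments. Unset Strict Implicit. Unset Printing Implicit Defensive.
Import GRing.Theory.
Local Open Scope ring_scope.

Record Grp := {
  gcar :> Type;
  gmul : gcar -> gcar -> gcar;
  ginv : gcar -> gcar;
  gone : gcar;
  gmulA : forall x y z, gmul x (gmul y z) = gmul (gmul x y) z;
  gmul1 : forall x, gmul gone x = x;
  gmulV : forall x, gmul (ginv x) x = gone
}.

Record subgroup (G : Grp) := {
  sg_mem :> G -> Prop;
  sg_one : sg_mem (gone G);
  sg_mul : forall x y, sg_mem x -> sg_mem y -> sg_mem (gmul x y);
  sg_inv : forall x, sg_mem x -> sg_mem (ginv x)
}.

Definition is_word (G : Grp) (S : seq G) (w : seq G) : Prop :=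
  forall x, List.In x w -> List.In x S \/ exists s, List.In s S /\ x = ginv s.

Definition wprod (G : Grp) (w : seq G) : G := foldr (@gmul G) (gone G) w.

Definition wlen_le (G : Grp) (S : seq G) (x : G) (n : nat) : Prop :=
  exists w, is_word S w /\ (size w <= n)%N /\ wprod w = x.

Definition generates (G : Grp) (S : seq G) : Prop :=
  forall x : G, exists n, wlen_le S x n.

Definition dist_le (G : Grp) (S : seq G) (x y : G) (n : nat) : Prop :=
  wlen_le S (gmul (ginv x) y) n.

Definition dist_lt (G : Grp) (S : seq G) (x y : G) (M : nat) : Prop :=
  exists n, (n < M)%N /\ dist_le S x y n.

Record gpair (G : Grp) := {
  pk : nat;
  pk_pos : (0 < pk)%N;
  pfam : 'I_pk -> subgroup G
}.

Record coset (G : Grp) (P : gpair G) := {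
  c_idx : 'I_(pk P);
  c_set : G -> Prop;
  c_ok : exists g : G, forall x, c_set x <-> exists p, @pfam G P c_idx p /\ x = gmul g p
}.

Definition coset_transl (G : Grp) (P : gpair G) (g : G) (A B : coset P) : Prop :=
  c_idx A = c_idx B /\ forall y, c_set B y <-> c_set A (gmul (ginv g) y).

Definition lipschitz (G H : Grp) (SG : seq G) (SH : seq H) (L C : nat)
    (f : G -> H) : Prop :=
  forall x y n, dist_le SG x y n -> dist_le SH (f x) (f y) (L * n + C).

(* Hausdorff distance between X and Y is < M (distances are integers, so
   this means every point of each set is at distance < M from the other) *)
Definition hausdorff_lt (H : Grp) (SH : seq H) (X Y : H -> Prop) (M : nat) : Prop :=
  (forall x, X x -> exists y, Y y /\ dist_lt SH x y M) /\
  (forall y, Y y -> exists x, X x /\ dist_lt SH x y M).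

Definition lipschitz_pair (G H : Grp) (SG : seq G) (SH : seq H)
    (P : gpair G) (Q : gpair H) (L C M : nat)
    (f1 : G -> H) (f2 : coset P -> coset Q) : Prop :=
  lipschitz SG SH L C f1 /\
  forall A : coset P,
    hausdorff_lt SH (fun h => exists g, c_set A g /\ h = f1 g) (c_set (f2 A)) M.

Definition quasi_retract (G H : Grp) (SG : seq G) (SH : seq H)
    (P : gpair G) (Q : gpair H) : Prop :=
  exists (L C M : nat) (f1 : G -> H) (f2 : coset P -> coset Q)
         (r1 : H -> G) (r2 : coset Q -> coset P),
    (1 <= L)%N /\
    @lipschitz_pair G H SG SH P Q L C M f1 f2 /\
    @lipschitz_pair H G SH SG Q P L C M r1 r2 /\
    (forall g, dist_le SG (r1 (f1 g)) g C) /\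
    (forall A, r2 (f2 A) = A).

Record ZGmod (G : Grp) := {
  mcar :> zmodType;
  mact : G -> mcar -> mcar;
  mact_add : forall g x y, mact g (x + y) = mact g x + mact g y;
  mact_one : forall x, mact (gone G) x = x;
  mact_mul : forall g h x, mact (gmul g h) x = mact g (mact h x)
}.

Record hom (G : Grp) (M N : ZGmod G) := {
  hfun :> M -> N;
  hadd : forall x y, hfun (x + y) = hfun x + hfun y;
  hequiv : forall g x, hfun (@mact G M g x) = @mact G N g (hfun x)
}.

Definition surjective_fun (A B : Type) (f : A -> B) : Prop :=
  forall b, exists a, f a = b.

Definition projective (G : Grp) (P : ZGmod G) : Prop :=
  forall (M N : ZGmod G) (p : hom M N) (u : hom P N),
    surjective_fun p -> exists v : hom P M, forall x, p (v x) = u x.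

Definition fg_mod (G : Grp) (P : ZGmod G) : Prop :=
  exists xs : seq P, forall m : P,
    exists l : seq (int * G * P),
      all (fun t => t.2 \in xs) l /\
      m = \sum_(t <- l) (@mact G P t.1.2 t.2) *~ t.1.1.

(* Z[G/P] is the module of finitely supported functions G/P -> Z with
   (g.f)(B) = f(g^-1 B); Delta is the kernel of the augmentation, i.e.
   the finitely supported functions with total sum 0. *)
Definition in_Delta (G : Grp) (P : gpair G) (f : coset P -> int) : Prop :=
  exists s : list (coset P), List.NoDup s /\
    (forall A, f A <> 0 -> List.In A s) /\
    foldr (fun A acc => f A + acc) 0 s = 0.

(* (G,P) of type FP_n: a projective resolution
     ... -> P_2 --d_1--> P_1 --d_0--> P_0 --eps--> Delta -> 0
   with P_i finitely generated for i = 0..n-1.  eps is given as a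
   ZG-linear map into functions G/P -> Z whose image is exactly Delta. *)
Definition FPn (G : Grp) (P : gpair G) (n : nat) : Prop :=
  exists (Pm : nat -> ZGmod G) (d : forall i, hom (Pm i.+1) (Pm i))
         (eps : Pm 0%N -> coset P -> int),
    (forall x y A, eps (x + y) A = eps x A + eps y A) /\
    (forall g x A B, coset_transl g A B -> eps (@mact G (Pm 0%N) g x) B = eps x A) /\
    (forall x, in_Delta (eps x)) /\
    (forall f, in_Delta f -> exists x, eps x = f) /\
    (forall x : Pm 0%N, eps x = (fun _ => 0) <-> exists y, d 0%N y = x) /\
    (forall i (x : Pm i.+1), d i x = 0 <-> exists y, d i.+1 y = x) /\
    (forall i, projective (Pm i)) /\
    (forall i, (i < n)%N -> fg_mod (Pm i)).

(* Main.v *)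
From mathcomp Require Import all_boot all_order all_algebra.
From mathcomp Require Import finmap boolp.
From mathcomp.multinomials Require Import xfinmap monalg.
Require Import Defs.

Set Implicit Arguments. Unset Strict Implicit. Unset Printing Implicit Defensive.
Import GRing.Theory Num.Theory BigEnoughFSet.
Local Open Scope ring_scope.

(** Augment a resolution of Delta_(H/Q) by Z[H/Q] to a complex F, and build a
    resolution of Delta_(G/P) by free modules, augmented by Z[G/P] to a complex E,
    choosing finitely many generators of the cycles at each stage whenever this is
    possible. Every finitely generated projective module, and also Z[G/P], has
    a notion of support that is locally finite and invariant, so that cycles of
    bounded support bound chains of bounded support: up to translation only
    finitely many generating cycles have to be filled, the integers being noetherian.
    Hence the quasi-retraction (f_1, r_1) lifts, over f_2 and r_2, to chain maps
    f : E -> F and r : F -> E that are not equivariant but move supports by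
    a bounded amount from their images under f_1 and r_1, and r f is homotopic to
    the identity by a homotopy of the same kind. If F is finitely generated in degree
    k+1, a k-cycle z of E is the sum of (id - r f - h d) z, and of r d w with d w = f z;
    both are sums of k-cycles of uniformly bounded support, so finitely many
    k-cycles generate all of them. *)

Lemma In_mem (T : eqType) (x : T) (s : seq T) : List.In x s <-> x \in s.
Proof.
elim: s => //= y s IH; rewrite inE; split=> [[->|/IH->]|/orP[/eqP->|/IH]].
- by rewrite eqxx.
- by rewrite orbT.
- by left.
by right.
Qed.

(** * Additive maps and subgroups *)

Definition addm (A B : zmodType) (f : A -> B) : Prop :=
  forall x y, f (x + y) = f x + f y.

Section Addm.
Context (A B C : zmodType).

Lemma addm0 (f : A -> B) : addm f -> f 0 = 0.
Proof. by move=> fD; apply: (addrI (f 0)); rewrite -fD !addr0. Qed.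

Lemma addmN (f : A -> B) : addm f -> forall x, f (- x) = - f x.
Proof. by move=> fD x; apply: (addrI (f x)); rewrite -fD !subrr addm0. Qed.

Lemma addmB (f : A -> B) : addm f -> forall x y, f (x - y) = f x - f y.
Proof. by move=> fD x y; rewrite fD addmN. Qed.

Lemma addmMz (f : A -> B) : addm f -> forall x (c : int), f (x *~ c) = f x *~ c.
Proof.
move=> fD x.
have fMn k : f (x *+ k) = f x *+ k.
  by elim: k => [|k IH]; rewrite ?mulr0n ?addm0 // !mulrS fD IH.
by case=> k; rewrite ?NegzE ?mulrNz -!pmulrn ?addmN ?fMn.
Qed.

Lemma addm_sum (f : A -> B) : addm f -> forall I (s : seq I) (F : I -> A),
  f (\sum_(i <- s) F i) = \sum_(i <- s) f (F i).
Proof.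
move=> fD I s F; elim: s => [|i s IH]; first by rewrite !big_nil addm0.
by rewrite !big_cons fD IH.
Qed.

Lemma addm_comp (g : B -> C) (f : A -> B) : addm g -> addm f -> addm (g \o f).
Proof. by move=> gD fD x y /=; rewrite fD gD. Qed.

Lemma addm_sub (f g : A -> B) : addm f -> addm g -> addm (fun x => f x - g x).
Proof. by move=> fD gD x y; rewrite fD gD opprD addrACA. Qed.

End Addm.

Definition zclosed (M : zmodType) (S : M -> Prop) : Prop :=
  [/\ S 0, forall x y, S x -> S y -> S (x + y) & forall x, S x -> S (- x)].

(** Impredicative, so that a hypothesis [zspan xs m] is itself an induction principle: it is applied
    to whatever subgroup should contain [m]. *)
Definition zspan (M : zmodType) (xs : seq M) (m : M) : Prop :=
  forall S : M -> Prop, zclosed S -> (forall x, x \in xs -> S x) -> S m.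

Section Zclosed.
Context (M : zmodType).
Implicit Types (S : M -> Prop) (xs : seq M).

Lemma zclosedB S : zclosed S -> forall x y, S x -> S y -> S (x - y).
Proof. by case=> _ SD SN x y Sx Sy; apply/SD/SN. Qed.

Lemma zclosedMz S : zclosed S -> forall x (c : int), S x -> S (x *~ c).
Proof.
case=> S0 SD SN x c Sx.
have Sn k : S (x *+ k) by elim: k => [|k IH]; rewrite ?mulr0n // mulrS; apply: SD.
by case: c => k; rewrite ?NegzE ?mulrNz -pmulrn; first exact: Sn; exact/SN/Sn.
Qed.

Lemma zclosed_preim (N : zmodType) (f : N -> M) S :
  addm f -> zclosed S -> zclosed (fun x => S (f x)).
Proof.
move=> fD [S0 SD SN]; split=> [|x y Sx Sy|x Sx]; rewrite ?addm0 ?fD ?addmN //.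
  exact: SD.
exact: SN.
Qed.

Lemma zclosed_and S S' : zclosed S -> zclosed S' -> zclosed (fun x => S x /\ S' x).
Proof.
move=> [S0 SD SN] [S0' SD' SN']; split=> // [x y [? ?] [? ?]|x [? ?]].
  by split; [apply: SD|apply: SD'].
by split; [apply: SN|apply: SN'].
Qed.

Lemma zclosed_zspan xs : zclosed (zspan xs).
Proof.
split=> [S [] //|x y hx hy S cS hS|x hx S cS hS]; case: (cS) => S0 SD SN.
  by apply: SD; [apply: hx|apply: hy].
by apply: SN; apply: hx.
Qed.

Lemma zspan_mem xs x : x \in xs -> zspan xs x.
Proof. by move=> xs_x S _; apply. Qed.

End Zclosed.

Section Zspan.
Context (M : zmodType).
Implicit Types (S : M -> Prop) (xs : seq M).

Lemma zspan_map (N : zmodType) (f : M -> N) xs m :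
  addm f -> zspan xs m -> zspan [seq f x | x <- xs] (f m).
Proof.
move=> fD hm; apply: (hm (fun m => zspan _ (f m))).
  exact: (zclosed_preim fD (zclosed_zspan _)).
by move=> x xs_x; apply: zspan_mem (map_f f xs_x).
Qed.

Lemma zspan_cons x xs m : zspan (x :: xs) m -> exists c : int, zspan xs (m - x *~ c).
Proof.
move=> hm; apply: (hm (fun m => exists c : int, zspan xs (m - x *~ c))).
  have [h0 hD hN] := zclosed_zspan xs.
  split=> [|y z [c hy] [d hz]|y [c hy]]; first by exists 0; rewrite mulr0z subr0.
    by exists (c + d); rewrite mulrzDr opprD addrACA; apply: hD.
  by exists (- c); rewrite mulrNz -opprD; apply: hN.
move=> y; rewrite inE => /orP[/eqP->|ys].
  by exists 1; rewrite mulr1z subrr; case: (zclosed_zspan xs).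
by exists 0; rewrite mulr0z subr0; apply: zspan_mem.
Qed.

Lemma zspan_nil (m : M) : zspan [::] m -> m = 0.
Proof.
move=> hm; apply: (hm (fun m => m = 0)) => //; split=> // [x y -> ->|x ->]; by rewrite ?addr0 ?oppr0.
Qed.

(** Induction on [xs]. The possible coefficients of [x] in elements of [S] form an ideal of the
    integers; an element [m0] realising its least positive member [d], together with generators of
    the elements of [S] that lie in the span of the tail, generates [S]. *)
Lemma zspan_noetherian xs S : zclosed S -> (forall m, S m -> zspan xs m) ->
  exists2 ys : seq M, (forall y, y \in ys -> S y) & forall m, S m -> zspan ys m.
Proof.
elim: xs S => [|x xs IH] S cS hS.
  by exists [::] => // m /hS/zspan_nil->; case: (zclosed_zspan [::]).
pose T m := S m /\ zspan xs m.
have cT : zclosed T by apply/zclosed_and/zclosed_zspan.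
have [ys ysT hys] := IH T cT (fun m => @proj2 _ _).
pose I (k : nat) := (0 < k)%N /\ exists2 m, S m & zspan xs (m - x *~ k%:Z).
have [[k0 Ik0]|noI] := pselect (exists k, I k); last first.
  exists ys => [y /ysT [] //|m Sm]; apply: hys; split=> //.
  have [c hc] := zspan_cons (hS m Sm).
  have [c0|c_neq0] := eqVneq c 0; first by move: hc; rewrite c0 mulr0z subr0.
  (* [I] speaks of positive coefficients only; for negative [c] the element [- m] is the witness. *)
  case: noI; exists `|c|%N; split; first by rewrite absz_gt0.
  case: (intP c) c_neq0 hc => // n _ hc; first by exists m.
  exists (- m); first by case: cS => _ _; apply.
  have [_ _ hN] := zclosed_zspan xs.
  by move/hN: hc; rewrite mulrNz opprK opprD abszN.
have [d [[d_gt0 [m0 Sm0 hm0]] d_min]] : exists d, I d /\ forall k, I k -> (d <= k)%N.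
  have exI : exists k, `[<I k>] by exists k0; apply/asboolP.
  case: (ex_minnP exI) => d /asboolP Id dmin; exists d; split=> // k Ik.
  exact/dmin/asboolP.
exists (m0 :: ys) => [y|m Sm].
  by rewrite inE => /orP[/eqP->//|/ysT[]].
have [c hc] := zspan_cons (hS m Sm).
(* Division with remainder: [m1] has the remainder of [c] modulo [d] as coefficient of [x], which
   must vanish by minimality of [d]. *)
pose m1 := m - m0 *~ (c %/ d%:Z)%Z.
have Sm1 : S m1 by apply: zclosedB => //; apply: zclosedMz.
have hm1 : zspan xs (m1 - x *~ (c %% d%:Z)%Z).
  have -> : m1 - x *~ (c %% d%:Z)%Z
      = (m - x *~ c) - (m0 - x *~ d%:Z) *~ (c %/ d%:Z)%Z.
    rewrite /m1; move: (c %/ d)%Z (c %% d)%Z (divz_eq c d) => q r ->.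
    rewrite mulrzBl -mulrzA mulrzDr [d%:Z * _]mulrC opprD opprB.
    by rewrite [RHS]addrA [LHS]addrAC; congr (_ - _); rewrite -addrA addrAC addNr add0r.
  apply: (zclosedB (zclosed_zspan xs)) => //; exact: (zclosedMz (zclosed_zspan xs)).
have c_mod : (c %% d%:Z)%Z = 0.
  have d_neq0 : d%:Z != 0 by rewrite -lt0n.
  have := modz_ge0 c d_neq0; have := ltz_pmod c (d := d%:Z).
  rewrite ltz_nat => /(_ d_gt0).
  case: (c %% d%:Z)%Z hm1 => // -[|k] // hm1; rewrite ltz_nat => kd _.
  have Ik : I k.+1 by split=> //; exists m1.
  by have := d_min _ Ik; rewrite leqNgt kd.
have hys1 : zspan ys m1.
  by apply: hys; split=> //; move: hm1; rewrite c_mod mulr0z subr0.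
have [_ hD _] := zclosed_zspan (m0 :: ys).
rewrite -(subrK (m0 *~ (c %/ d%:Z)%Z) m); apply: hD.
  by move=> S' cS' S'ys; apply: hys1 => // y yys; apply: S'ys; rewrite inE yys orbT.
by apply: (zclosedMz (zclosed_zspan _)); apply: zspan_mem; rewrite inE eqxx.
Qed.

End Zspan.

(** * Free abelian groups *)

(** [{classic X}] supplies the choice structure that [malg] demands, so [X] may be any type, such as
    a type of cosets. *)
Definition freeab (X : Type) : zmodType := {malg int[{classic X}]}.

Definition basis (X : Type) (x : X) : freeab X := << (x : {classic X}) >>.

Definition coef (X : Type) (m : freeab X) (x : X) : int := m@_(x : {classic X}).

Definition ext (X : Type) (A : zmodType) (phi : X -> A) (m : freeab X) : A :=
  \sum_(x <- msupp m) phi x *~ coef m x.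

Section Freeab.
Context (X : Type).
Implicit Types (m : freeab X) (x : X).

Lemma coefD x m1 m2 : coef (m1 + m2) x = coef m1 x + coef m2 x.
Proof. exact: mcoeffD. Qed.

Lemma coef0 x : coef 0 x = 0.
Proof. exact: mcoeff0. Qed.

Lemma coefN x m : coef (- m) x = - coef m x.
Proof. exact: mcoeffN. Qed.

Lemma coefMz x m (k : int) : coef (m *~ k) x = coef m x *~ k.
Proof. exact: (addmMz (f := fun m => coef m x) (coefD x)). Qed.

Lemma coefP m1 m2 : (forall x, coef m1 x = coef m2 x) -> m1 = m2.
Proof. by move=> e; apply/malgP. Qed.

Lemma coef_basis x y : coef (basis x) y = ((x : {classic X}) == y)%:R.
Proof. by rewrite /coef /basis mcoeffU. Qed.

Lemma coef_basis_neq0 x y : coef (basis x) y <> 0 -> y = x.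
Proof. by rewrite coef_basis; case: eqP. Qed.

Lemma zclosed_supp (S : freeab X -> Prop) m : zclosed S ->
  (forall x, coef m x <> 0 -> S (basis x)) -> S m.
Proof.
move=> cS; rewrite [in S m](monalgE m) /coef => hS.
rewrite big_seq; elim/big_ind: _; try by case: cS.
move=> x; rewrite -mcoeff_neq0 => /eqP mx.
have -> : << m@_x *g x >> = (basis x) *~ m@_x.
  by rewrite /basis -[m@_x in LHS]intz -mulrzr mul1r -(addmMz (f := mkmalgU x)) //; exact: monalgUD.
exact/(zclosedMz cS)/hS.
Qed.

Lemma additive_eq (A : zmodType) (f g : freeab X -> A) : addm f -> addm g ->
  (forall x, f (basis x) = g (basis x)) -> forall m, f m = g m.
Proof.
move=> fD gD fg m; apply: (zclosed_supp (S := fun m => f m = g m)) => //.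
split=> [|x y|x]; first by rewrite !addm0.
  by rewrite fD gD => -> ->.
by rewrite !addmN // => ->.
Qed.

Section Ext.
Context (A : zmodType) (phi : X -> A).

Lemma extD : addm (ext phi).
Proof.
(* The sum may run over any finite set containing the support; the supports of [m1], [m2] and
   [m1 + m2] are then replaced by one common set. *)
have extE (E : {fset {classic X}}) m : fsubset (msupp m) E ->
    ext phi m = \sum_(x <- E) phi x *~ coef m x.
  move=> le; rewrite [LHS](big_fset_incl _ le) => //= x xE.
  by rewrite /coef => /mcoeff_outdom ->; rewrite mulr0z.
move=> m1 m2; pose_big_fset {classic X} E; rewrite 3?(extE E) //.
  by rewrite -big_split; apply: eq_bigr => x _; rewrite coefD mulrzDr.
by close.
Qed.

Lemma ext_basis x : ext phi (basis x) = phi x.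
Proof.
rewrite /ext /basis msuppU oner_eq0 big_seq_fset1.
by rewrite /coef mcoeffUU mulr1z.
Qed.

Lemma ext_supp (S : A -> Prop) m : zclosed S ->
  (forall x, coef m x <> 0 -> S (phi x)) -> S (ext phi m).
Proof.
move=> cS hS; apply: (zclosed_supp (zclosed_preim extD cS)) => x /hS.
by rewrite ext_basis.
Qed.

End Ext.

End Freeab.

(** * Groups and modules *)

Section GrpTheory.
Context (G : Grp).
Implicit Types x y z : G.

Lemma gmulrV x : gmul x (ginv x) = gone G.
Proof.
rewrite -[LHS]gmul1 -{1}(gmulV (ginv x)) -gmulA [gmul (ginv x) (gmul _ _)]gmulA.
by rewrite gmulV gmul1 gmulV.
Qed.

Lemma gmulr1 x : gmul x (gone G) = x.
Proof. by rewrite -(gmulV x) gmulA gmulrV gmul1. Qed.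

Lemma gmulK x y : gmul (ginv x) (gmul x y) = y.
Proof. by rewrite gmulA gmulV gmul1. Qed.

Lemma gmulVK x y : gmul x (gmul (ginv x) y) = y.
Proof. by rewrite gmulA gmulrV gmul1. Qed.

Lemma gmulI x y z : gmul x y = gmul x z -> y = z.
Proof. by move=> e; rewrite -(gmulK x y) e gmulK. Qed.

Lemma ginvK x : ginv (ginv x) = x.
Proof. by apply: (@gmulI (ginv x)); rewrite gmulrV gmulV. Qed.

Lemma ginv1 : ginv (gone G) = gone G.
Proof. by rewrite -[LHS]gmulr1 gmulV. Qed.

Lemma ginvM x y : ginv (gmul x y) = gmul (ginv y) (ginv x).
Proof.
by apply: (@gmulI (gmul x y)); rewrite gmulrV -gmulA gmulVK gmulrV.
Qed.

Lemma wprod_cat (u v : seq G) : wprod (u ++ v) = gmul (wprod u) (wprod v).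
Proof. by elim: u => [|x u IH] /=; rewrite ?gmul1 // IH gmulA. Qed.

Lemma wprod_inv (w : seq G) : wprod [seq ginv x | x <- rev w] = ginv (wprod w).
Proof.
elim: w => [|x w IH] /=; first by rewrite ginv1.
by rewrite rev_cons map_rcons -cats1 wprod_cat IH ginvM /= gmulr1.
Qed.

Context (S : seq G).

Lemma wlen_le_mono x a b : (a <= b)%N -> wlen_le S x a -> wlen_le S x b.
Proof. by move=> ab [w [? [wa ?]]]; exists w; split=> //; split=> //; apply: leq_trans ab. Qed.

Lemma wlen_le1 a : wlen_le S (gone G) a.
Proof. by exists [::]; split=> [x []|]. Qed.

Lemma wlen_leM x y a b : wlen_le S x a -> wlen_le S y b -> wlen_le S (gmul x y) (a + b).
Proof.
move=> [u [uS [ua <-]]] [v [vS [vb <-]]]; exists (u ++ v).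
rewrite size_cat wprod_cat leq_add //; split=> // z zuv.
by have [/uS|/vS] := List.in_app_or _ _ _ zuv.
Qed.

Lemma wlen_leV x a : wlen_le S x a -> wlen_le S (ginv x) a.
Proof.
move=> [w [wS [wa <-]]]; exists [seq ginv x | x <- rev w].
rewrite size_map size_rev wprod_inv; split=> // z zw.
have [y [<-]] := proj1 (List.in_map_iff _ _ _) zw.
elim: w {wa zw} wS => // t w IH wS; rewrite rev_cons -cats1 => yw.
have [yr|[<-|//]] := List.in_app_or _ _ _ yw.
  by apply: IH => // s ws; apply: wS; right.
have [ts|[s [sS ->]]] := wS t (or_introl erefl); first by right; exists t.
by left; rewrite ginvK.
Qed.

Lemma dist_le_refl x a : dist_le S x x a.
Proof. by rewrite /dist_le gmulV; apply: wlen_le1. Qed.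

Lemma dist_le_sym x y a : dist_le S x y a -> dist_le S y x a.
Proof. by move=> /wlen_leV; rewrite /dist_le ginvM ginvK. Qed.

Lemma dist_le_trans y x z a b :
  dist_le S x y a -> dist_le S y z b -> dist_le S x z (a + b).
Proof. by move=> h h'; have := wlen_leM h h'; rewrite -gmulA gmulVK. Qed.

Lemma dist_le_mono x y a b : (a <= b)%N -> dist_le S x y a -> dist_le S x y b.
Proof. exact: wlen_le_mono. Qed.

Lemma dist_le_mull g x y a : dist_le S (gmul g x) (gmul g y) a <-> dist_le S x y a.
Proof. by rewrite /dist_le ginvM -gmulA gmulK. Qed.

(** Induction on the radius: a nonempty word is a generator or an inverse of one, times a shorter
    word. *)
Lemma ball_finite a : exists B : seq G, forall x, wlen_le S x a -> List.In x B.
Proof.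
elim: a => [|a [B hB]].
  by exists [:: gone G] => x [[|y w] [_ [//= _ <-]]]; left.
exists (B ++ [seq gmul s b | s <- S ++ [seq ginv s | s <- S], b <- B])%SEQ.
move=> x [[|y w] [wS [wa <-]]].
  by apply: List.in_or_app; left; apply: hB; apply: wlen_le1.
apply: List.in_or_app; right.
have wB : List.In (wprod w) B.
  by apply: hB; exists w; split=> // z zw; apply: wS; right.
have yS : List.In y (S ++ [seq ginv s | s <- S]).
  apply: List.in_or_app; have [|[s [sS ->]]] := wS y (or_introl erefl); first by left.
  by right; apply: List.in_map.
elim: (S ++ _)%SEQ yS => //= t T IH [->|/IH h]; apply: List.in_or_app.
  by left; apply: (List.in_map (gmul y)).
by right.
Qed.

End GrpTheory.

Section ModTheory.
Context (G : Grp) (M : ZGmod G).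
Implicit Types (S : M -> Prop) (g : G).

Lemma mactVK g : cancel (@mact G M (ginv g)) (mact g).
Proof. by move=> x; rewrite -mact_mul gmulrV mact_one. Qed.

Definition gclosed S : Prop := zclosed S /\ forall g x, S x -> S (mact g x).

Definition gspan (X : M -> Prop) (m : M) : Prop :=
  forall S, gclosed S -> (forall x, X x -> S x) -> S m.

(** For predicates on [M], because submodules of cycles are kept as predicates throughout and not
    turned into modules. *)
Definition fin_gen S : Prop :=
  exists xs : seq M, forall m, S m <-> gspan (fun x => x \in xs) m.

Lemma gclosed_gspan (X : M -> Prop) : gclosed (gspan X).
Proof.
split; first split=> [S [[? ? ?] ?] _ //|x y hx hy S gS hS|x hx S gS hS].
- by case: (gS) => -[_ SD _] _; apply: SD; [apply: hx|apply: hy].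
- by case: (gS) => -[_ _ SN] _; apply: SN; apply: hx.
by move=> g x hx S gS hS; case: (gS) => _; apply; apply: hx.
Qed.

(** The explicit linear combinations form a submodule containing [xs], hence exhaust its span;
    conversely each of them lies in every submodule containing [xs]. *)
Lemma fg_modP : fg_mod M <-> fin_gen (fun _ => True).
Proof.
split=> [[xs hxs]|[xs hxs]]; exists xs => m; last first.
  have [h _] := hxs m; pose lincomb m' := exists l : seq (int * G * M),
    all (fun t => t.2 \in xs) l /\ m' = \sum_(t <- l) (mact t.1.2 t.2) *~ t.1.1.
  apply: (h I lincomb) => [|x x_xs]; last first.
    by exists [:: (1, gone G, x)]; rewrite /= x_xs big_seq1 mact_one mulr1z.
  split; first split.
  - by exists [::]; rewrite big_nil.
  - move=> x y [l [lxs ->]] [l' [lxs' ->]]; exists (l ++ l').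
    by rewrite all_cat lxs big_cat.
  - move=> x [l [lxs ->]]; exists [seq (- t.1.1, t.1.2, t.2) | t <- l].
    rewrite all_map big_map -sumrN; split=> //.
    by apply: eq_bigr => t _; rewrite mulrNz.
  move=> g x [l [lxs ->]]; exists [seq (t.1.1, gmul g t.1.2, t.2) | t <- l].
  rewrite all_map big_map (addm_sum (@mact_add _ _ g)); split=> //.
  by apply: eq_bigr => t _; rewrite mact_mul (addmMz (@mact_add _ _ g)).
split=> // _ S [cS gS] hS; have [l [lxs ->]] := hxs m.
elim: l lxs => [_|t l IH /= /andP[tx /IH hl]]; first by rewrite big_nil; case: cS.
rewrite big_cons; case: (cS) => _ SD _; apply: SD => //.
by apply: (zclosedMz cS); apply/gS/hS.
Qed.

End ModTheory.

Lemma hom_gclosed (G : Grp) (M N : ZGmod G) (f : hom M N) (S : N -> Prop) :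
  gclosed S -> gclosed (fun x => S (f x)).
Proof.
move=> [cS gS]; split; first exact: (zclosed_preim (@hadd _ _ _ f) cS).
by move=> g x Sx; rewrite hequiv; apply: gS.
Qed.

Lemma hom_ker_gclosed (G : Grp) (M N : ZGmod G) (f : hom M N) :
  gclosed (fun x => f x = 0).
Proof.
apply: (@hom_gclosed _ _ _ f (fun y => y = 0)); split; first split=> //.
- by move=> x y -> ->; rewrite addr0.
- by move=> x ->; rewrite oppr0.
by move=> g x ->; rewrite (addm0 (@mact_add _ _ g)).
Qed.

(** * Permutation modules *)

Record Gset (G : Grp) := {
  gs_car :> Type;
  gs_act : G -> gs_car -> gs_car;
  gs_act1 : forall x, gs_act (gone G) x = x;
  gs_actM : forall g h x, gs_act (gmul g h) x = gs_act g (gs_act h x)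
}.

Section PermMod.
Context (G : Grp) (X : Gset G).

Let act (g : G) : freeab X -> freeab X := ext (fun x => basis (gs_act g x)).

Lemma perm_act1 m : act (gone G) m = m.
Proof.
apply: (additive_eq (f := act _) (g := id)) => // [|x]; first exact: extD.
by rewrite /act ext_basis gs_act1.
Qed.

Lemma perm_actM g h m : act (gmul g h) m = act g (act h m).
Proof.
apply: (additive_eq (f := act _) (g := act g \o act h)) => [||x].
- exact: extD.
- by apply: addm_comp; apply: extD.
by rewrite /act /= !ext_basis gs_actM.
Qed.

Definition perm_mod : ZGmod G :=
  Build_ZGmod (fun g => @extD _ _ (fun x => basis (gs_act g x))) perm_act1 perm_actM.

Lemma mact_basis g x : @mact G perm_mod g (basis x) = basis (gs_act g x).
Proof. exact: ext_basis. Qed.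

Lemma coef_mact g (m : perm_mod) x : coef (mact g m) (gs_act g x) = coef m x.
Proof.
apply: (additive_eq (f := fun m => coef (@mact G perm_mod g m) (gs_act g x))
  (g := fun m => coef m x)) => [m1 m2|m1 m2|y].
- by rewrite mact_add coefD.
- exact: coefD.
rewrite mact_basis !coef_basis; congr (_%:R); congr nat_of_bool.
apply/eqP/eqP => [e|-> //].
by rewrite -(gs_act1 y) -(gmulV g) gs_actM e -gs_actM gmulV gs_act1.
Qed.

Lemma ext_equiv (M : ZGmod G) (phi : X -> M) :
  (forall g x, phi (gs_act g x) = mact g (phi x)) ->
  forall g (m : perm_mod), ext phi (mact g m) = mact g (ext phi m).
Proof.
move=> phiE g; apply: additive_eq => [m1 m2|m1 m2|x].
- by rewrite mact_add extD.
- by rewrite extD mact_add.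
by rewrite mact_basis !ext_basis.
Qed.

Definition ext_hom (M : ZGmod G) (phi : X -> M)
    (phiE : forall g x, phi (gs_act g x) = mact g (phi x)) : hom perm_mod M :=
  @Build_hom G perm_mod M (ext phi) (@extD _ _ phi) (ext_equiv phiE).

End PermMod.

(** * Free modules and their retracts *)

Section FreeMod.
Context (G : Grp).

(** Free modules are obtained as permutation modules, so that [perm_geom] serves both for them and
    for the module of cosets. *)
Definition free_gset (I : Type) : Gset G.
Proof.
by exists (G * I)%type (fun g x => (gmul g x.1, x.2)) => [[x i]|g h [x i]] /=;
  rewrite ?gmul1 ?gmulA.
Defined.

Definition free_mod (I : Type) : ZGmod G := perm_mod (free_gset I).

Definition free_gen I (i : I) : free_mod I := @basis (free_gset I) (gone G, i).

Lemma free_lift_equiv I (M : ZGmod G) (v : I -> M) g (x : free_gset I) :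
  mact (gs_act g x).1 (v (gs_act g x).2) = mact g (mact x.1 (v x.2)).
Proof. by rewrite mact_mul. Qed.

Definition free_lift I (M : ZGmod G) (v : I -> M) : hom (free_mod I) M :=
  ext_hom (free_lift_equiv v).

Lemma free_lift_gen I (M : ZGmod G) (v : I -> M) i : free_lift v (free_gen i) = v i.
Proof. by rewrite [LHS]ext_basis mact_one. Qed.

Lemma free_basisE I (x : free_gset I) :
  @basis (free_gset I) x = mact x.1 (free_gen x.2 : free_mod I).
Proof. by rewrite mact_basis /= gmulr1; case: x. Qed.

Lemma hom_free_eq I (M : ZGmod G) (f g : hom (free_mod I) M) :
  (forall i, f (free_gen i) = g (free_gen i)) -> forall x, f x = g x.
Proof.
move=> fg; apply: (@additive_eq (free_gset I) _ f g (@hadd _ _ _ f) (@hadd _ _ _ g)).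
by move=> x; rewrite free_basisE !hequiv fg.
Qed.

Definition hom_comp (M N K : ZGmod G) (g : hom N K) (f : hom M N) : hom M K.
Proof.
exists (g \o f) => [x y|h x] /=; first by rewrite !hadd.
by rewrite !hequiv.
Defined.

Lemma free_projective I : projective (free_mod I).
Proof.
move=> M N p u p_surj.
have [v hv] := choice (fun i : I => p_surj (u (free_gen i))).
exists (free_lift v); apply: (hom_free_eq (f := hom_comp p (free_lift v))) => i.
by rewrite -hv -(free_lift_gen v i).
Qed.

Lemma free_gspan I (S : free_mod I -> Prop) :
  gclosed S -> (forall i, S (free_gen i)) -> forall m, S m.
Proof.
move=> [cS gS] hS m; apply: (@zclosed_supp (free_gset I) _ _ cS) => x _.
by rewrite free_basisE; apply: gS.
Qed.

Lemma free_fg_mod k : fg_mod (free_mod 'I_k).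
Proof.
apply/fg_modP; exists [seq free_gen i | i <- enum 'I_k] => m; split=> // _ S gS hS.
by apply: free_gspan => // i; apply: hS; apply: map_f; rewrite mem_enum.
Qed.

(** The splitting is what gets used: [s] pulls the geometry of a free module back to [M], and [p]
    reduces lifting problems on [M] to basis elements. *)
Definition free_retract (M : ZGmod G) : Prop :=
  exists k (s : hom M (free_mod 'I_k)) (p : hom (free_mod 'I_k) M),
    forall x, p (s x) = x.

(** Finitely many generators give a surjection [p] from a free module, and projectivity lifts the
    identity of [M] through it. *)
Lemma fg_projective_retract (M : ZGmod G) :
  projective M -> fg_mod M -> free_retract M.
Proof.
move=> prM /fg_modP[xs hxs]; exists (size xs).
pose p := free_lift (tnth (in_tuple xs)).
have p_surj : surjective_fun p.
  move=> m; have [h _] := hxs m.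
  apply: (h I (fun m => exists a, p a = m)) => [|x /seq_tnthP[i ->]].
    split; first split.
    - by exists 0; rewrite (addm0 (@hadd _ _ _ p)).
    - by move=> _ _ [a <-] [b <-]; exists (a + b); rewrite hadd.
    - by move=> _ [a <-]; exists (- a); rewrite (addmN (@hadd _ _ _ p)).
    by move=> g _ [a <-]; exists (mact g a); rewrite hequiv.
  by exists (free_gen i); rewrite free_lift_gen.
pose idM : hom M M := Build_hom (hfun := id) (fun x y => erefl) (fun g x => erefl).
by have [s hs] := prM _ _ p idM p_surj; exists s, p.
Qed.

End FreeMod.

(** * Modules with a coarse geometry *)

(* [near R g m] reads "the support of [m] lies in the ball of radius [R] about
   [g]". *)
Record geom (G : Grp) (S : seq G) (M : ZGmod G) := Geom {
  near : nat -> G -> M -> Prop;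
  near_z : forall R g, zclosed (near R g);
  near_act : forall R g h m, near R h m -> near R (gmul g h) (mact g m);
  near_shift : forall R D g h m, dist_le S g h D -> near R g m -> near (R + D) h m;
  near_fin : forall R, exists xs, forall m, near R (gone G) m -> zspan xs m;
  near_exh : forall m, exists R, near R (gone G) m;
  near_gen : exists R, forall X, zclosed X ->
    (forall g m, near R g m -> X m) -> forall m, X m
}.

(** The version of [geom] for points: [nr_fin] is local finiteness, and [nr_gen] says that balls of
    one fixed radius cover [X]. *)
Record gset_geom (G : Grp) (S : seq G) (X : Gset G) := GsetGeom {
  nr : nat -> G -> X -> Prop;
  nr_act : forall R g h x, nr R h x -> nr R (gmul g h) (gs_act g x);
  nr_shift : forall R D g h x, dist_le S g h D -> nr R g x -> nr (R + D) h x;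
  nr_fin : forall R, exists xs : seq X, forall x, nr R (gone G) x -> List.In x xs;
  nr_exh : forall x, exists R, nr R (gone G) x;
  nr_gen : exists R, forall x, exists g, nr R g x
}.

Lemma near_mono (G : Grp) (S : seq G) (M : ZGmod G) (A : geom S M) R R' g m :
  (R <= R')%N -> near A R g m -> near A R' g m.
Proof.
by move=> le h; rewrite -(subnKC le); apply: near_shift h; apply: dist_le_refl.
Qed.

Section PermGeom.
Context (G : Grp) (S : seq G) (X : Gset G) (A : gset_geom S X).

Definition perm_near (R : nat) (g : G) (m : perm_mod X) : Prop :=
  forall x, coef m x <> 0 -> nr A R g x.

Lemma perm_near_z R g : zclosed (perm_near R g).
Proof.
split=> [x []|m m' hm hm' x|m hm x]; first by rewrite coef0.
  rewrite coefD; have [m0|/eqP/hm //] := eqVneq (coef m x) 0.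
  by rewrite m0 add0r; apply: hm'.
by rewrite coefN => mx; apply: hm => mx0; rewrite mx0 oppr0 in mx.
Qed.

Lemma perm_near_act R g h m : perm_near R h m -> perm_near R (gmul g h) (mact g m).
Proof.
move=> hm x; have -> : x = gs_act g (gs_act (ginv g) x).
  by rewrite -gs_actM gmulrV gs_act1.
by rewrite coef_mact => /hm; apply: nr_act.
Qed.

Lemma perm_near_shift R D g h m : dist_le S g h D -> perm_near R g m -> perm_near (R + D) h m.
Proof. by move=> gh hm x /hm; apply: nr_shift. Qed.

Lemma perm_near_basis R g x : nr A R g x -> perm_near R g (basis x).
Proof. by move=> hx y yx; rewrite (coef_basis_neq0 yx). Qed.

Lemma perm_near_fin R : exists xs, forall m, perm_near R (gone G) m -> zspan xs m.
Proof.
have [xs hxs] := nr_fin A R; exists [seq basis x | x <- xs] => m hm.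
apply: (zclosed_supp (zclosed_zspan _)) => x /hm/hxs x_xs; apply: zspan_mem.
elim: xs x_xs {hxs} => //= y xs IH [->|/IH h]; rewrite inE ?eqxx //.
by rewrite h orbT.
Qed.

Lemma perm_near_exh m : exists R, perm_near R (gone G) m.
Proof.
apply: (zclosed_supp (S := fun m => exists R, perm_near R (gone G) m)).
  have mono R D g m' : perm_near R g m' -> perm_near (R + D) g m'.
    by apply: perm_near_shift; apply: dist_le_refl.
  split=> [|x y [R hx] [D hy]|x [R hx]].
  - by exists 0%N; case: (perm_near_z 0 (gone G)).
  - exists (R + D)%N; case: (perm_near_z (R + D) (gone G)) => _ hD _; apply: hD.
      exact: mono.
    by rewrite addnC; apply: mono.
  by exists R; case: (perm_near_z R (gone G)) => _ _; apply.
by move=> x _; have [R hx] := nr_exh A x; exists R; apply: perm_near_basis.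
Qed.

Lemma perm_near_gen : exists R, forall Y, zclosed Y ->
    (forall g m, perm_near R g m -> Y m) -> forall m, Y m.
Proof.
have [R hR] := nr_gen A; exists R => Y cY hY m.
apply: (zclosed_supp cY) => x _; have [g hx] := hR x.
by apply: (hY g); apply: perm_near_basis.
Qed.

Definition perm_geom : geom S (perm_mod X) :=
  Geom perm_near_z perm_near_act perm_near_shift perm_near_fin perm_near_exh perm_near_gen.

Lemma near_basis R g x : nr A R g x -> near perm_geom R g (basis x).
Proof. exact: perm_near_basis. Qed.

Lemma near_supp R g m : near perm_geom R g m -> forall x, coef m x <> 0 -> nr A R g x.
Proof. by []. Qed.

End PermGeom.

Lemma gen_dist (G : Grp) (S : seq G) : generates S ->
  forall x y : G, exists n, dist_le S x y n.
Proof. by move=> gS x y; apply: gS. Qed.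

Definition free_gset_geom (G : Grp) (S : seq G) (gS : generates S) k :
  gset_geom S (free_gset G 'I_k).
Proof.
exists (fun R g x => dist_le S g x.1 R).
- by move=> R g h x; rewrite /= dist_le_mull.
- move=> R D g h x gh gx; rewrite addnC; apply: dist_le_trans gx.
  exact: dist_le_sym.
- move=> R; have [B hB] := ball_finite S R.
  exists (List.list_prod B (enum 'I_k)) => -[x i] /= hx.
  apply: List.in_prod; last by apply/In_mem; rewrite mem_enum.
  by apply: hB; move: hx; rewrite /dist_le ginv1 gmul1.
- by move=> x; apply: gen_dist.
by exists 0%N => x; exists x.1; apply: dist_le_refl.
Defined.

(** * Controlled maps *)

Section Controlled.
Context (G H : Grp) (S : seq G) (T : seq H) (c : G -> H).

Definition coarse : Prop :=
  forall D, exists D', forall x y, dist_le S x y D -> dist_le T (c x) (c y) D'.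

(** [R'] does not depend on [g]. This uniformity replaces equivariance, which makes no sense over a
    mere map [c] of groups. *)
Definition controlled (M : ZGmod G) (N : ZGmod H) (A : geom S M) (B : geom T N)
    (phi : M -> N) : Prop :=
  forall R, exists R', forall g m, near A R g m -> near B R' (c g) (phi m).

End Controlled.

Lemma controlled_comp (G H K : Grp) (S : seq G) (T : seq H) (U : seq K)
  (c : G -> H) (c' : H -> K) (M : ZGmod G) (N : ZGmod H) (L : ZGmod K)
  (A : geom S M) (B : geom T N) (C : geom U L) phi psi :
  controlled c A B phi -> controlled c' B C psi ->
  controlled (c' \o c) A C (psi \o phi).
Proof.
move=> h h' R; have [R1 h1] := h R; have [R2 h2] := h' R1.
by exists R2 => g m /h1/h2.
Qed.

(** Serves to regard a map controlled over [c' \o c] as controlled over the identity when the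
    composite is at bounded distance from it. *)
Lemma controlled_close (G H : Grp) (S : seq G) (T : seq H) (c c' : G -> H) D
  (M : ZGmod G) (N : ZGmod H) (A : geom S M) (B : geom T N) phi :
  (forall g, dist_le T (c g) (c' g) D) ->
  controlled c A B phi -> controlled c' A B phi.
Proof.
move=> cc' h R; have [R' h'] := h R; exists (R' + D)%N => g m /h'.
exact: near_shift.
Qed.

Lemma controlled_sub (G H : Grp) (S : seq G) (T : seq H) (c : G -> H)
  (M : ZGmod G) (N : ZGmod H) (A : geom S M) (B : geom T N) phi psi :
  controlled c A B phi -> controlled c A B psi ->
  controlled c A B (fun m => phi m - psi m).
Proof.
move=> h h' R; have [R1 h1] := h R; have [R2 h2] := h' R.
exists (R1 + R2)%N => g m hm; apply: (zclosedB (near_z B _ _)).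
  exact: near_mono (leq_addr _ _) (h1 g m hm).
exact: near_mono (leq_addl _ _) (h2 g m hm).
Qed.

Section Homs.
Context (G : Grp) (S : seq G).

Lemma near_translate (M : ZGmod G) (A : geom S M) R g m :
  near A R g m -> near A R (gone G) (mact (ginv g) m).
Proof. by move=> /(near_act (ginv g)); rewrite gmulV. Qed.

Lemma near_exh_seq (M : ZGmod G) (A : geom S M) (xs : seq M) :
  exists R, forall x, x \in xs -> near A R (gone G) x.
Proof.
elim: xs => [|x xs [R hR]]; first by exists 0%N.
have [R' hR'] := near_exh A x; exists (R + R')%N => y.
rewrite inE => /orP[/eqP->|/hR]; apply: near_mono; last exact: leq_addr.
  exact: leq_addl.
by [].
Qed.

(** The elements near 1 lie in the span of a finite list, whose images share one radius;
    equivariance carries this radius to every [g]. *)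
Lemma hom_controlled (M N : ZGmod G) (A : geom S M) (B : geom S N) (f : hom M N) :
  controlled id A B f.
Proof.
move=> R; have [xs hxs] := near_fin A R.
have [R' hR'] := near_exh_seq B [seq f x | x <- xs].
exists R' => g m /near_translate/hxs/(zspan_map (@hadd _ _ _ f)) h.
have /(near_act g) := h _ (near_z B R' (gone G)) hR'.
by rewrite gmulr1 hequiv mactVK.
Qed.

(* Fillings can be chosen close to what they fill: by translation it is enough
   to fill finitely many generators of the boundaries near 1. *)
Lemma controlled_filling (N' N : ZGmod G) (B' : geom S N') (B : geom S N)
  (d : hom N' N) R : exists R', forall g n, near B R g n -> (exists y, d y = n) ->
  exists2 y, near B' R' g y & d y = n.
Proof.
have dD := @hadd _ _ _ d.
pose im n := exists y, d y = n.
have cim : zclosed im.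
  split=> [|_ _ [x <-] [y <-]|_ [x <-]]; first by exists 0; rewrite addm0.
    by exists (x + y).
  by exists (- x); rewrite addmN.
have [xs hxs] := near_fin B R.
(* The boundaries near 1 form a subgroup of a finitely generated abelian group, hence are generated
   by finitely many of them. *)
have [ys ysP hys] := zspan_noetherian (zclosed_and (near_z B R (gone G)) cim)
  (fun m hm => hxs m (proj1 hm)).
have [R' hR'] : exists R', forall y, y \in ys -> exists2 x, near B' R' (gone G) x & d x = y.
  have {ysP} : forall y, y \in ys -> im y by move=> y /ysP[].
  elim: ys {hys} => [|y ys IH] hy; first by exists 0%N.
  have [R1 h1] : exists R', forall y, y \in ys -> exists2 x, near B' R' (gone G) x & d x = y.
    by apply: IH => z zys; apply: hy; rewrite inE zys orbT.
  have [x dx] := hy y (mem_head _ _); have [R2 h2] := near_exh B' x.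
  exists (R1 + R2)%N => z; rewrite inE => /orP[/eqP->|/h1[w hw dw]].
    by exists x => //; apply: near_mono h2; apply: leq_addl.
  by exists w => //; apply: near_mono hw; apply: leq_addr.
exists R' => g n /near_translate hn [y dy].
have hz : zspan ys (mact (ginv g) n).
  by apply: hys; split=> //; exists (mact (ginv g) y); rewrite hequiv dy.
have [z hz1 dz] : exists2 z, near B' R' (gone G) z & d z = mact (ginv g) n.
  apply: (hz (fun n => exists2 z, near B' R' (gone G) z & d z = n)) => //.
  have [h0 hD hN] := near_z B' R' (gone G).
  split=> [|_ _ [u hu <-] [v hv <-]|_ [u hu <-]]; first by exists 0; rewrite ?addm0.
    by exists (u + v) => //; apply: hD.
  by exists (- u); rewrite ?addmN //; apply: hN.
exists (mact g z); last by rewrite hequiv dz mactVK.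
by have := near_act g hz1; rewrite gmulr1.
Qed.

End Homs.

(** * Geometry and lifting for retracts of free modules *)

Section Retract.
Context (G : Grp) (S : seq G) (gS : generates S) (M : ZGmod G).

Let F k := perm_geom (free_gset_geom gS k).

(** An element of [M] is near [g] when its image under [s] is. For [near_gen], [M] is generated by
    the elements [p y] with [y] of bounded support, and these are again near because [s \o p] is
    controlled. *)
Lemma retract_geom : free_retract M -> exists A : geom S M, True.
Proof.
case=> k [s [p ps]].
have sD := @hadd _ _ _ s; have pD := @hadd _ _ _ p.
pose rnear R g m := near (F k) R g (s m).
suff [h1 h2 h3 h4] : [/\ (forall R g, zclosed (rnear R g)),
    forall R, exists xs, forall m, rnear R (gone G) m -> zspan xs m,
    forall R g h m, rnear R h m -> rnear R (gmul g h) (mact g m) &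
    exists R, forall X, zclosed X -> (forall g m, rnear R g m -> X m) -> forall m, X m].
  exists (Geom h1 h3 (fun R D g h m => @near_shift _ _ _ (F k) R D g h (s m)) h2
    (fun m => near_exh (F k) (s m)) h4); done.
split.
- by move=> R g; apply: (zclosed_preim sD (near_z _ _ _)).
- move=> R; have [xs hxs] := near_fin (F k) R; exists [seq p x | x <- xs] => m.
  by move=> /hxs/(zspan_map pD); rewrite ps.
- by move=> R g h m; rewrite /rnear hequiv; apply: near_act.
have [R0 hR0] := near_gen (F k).
have [R hR] := hom_controlled (F k) (F k) (hom_comp s p) R0.
exists R => X cX hX m; rewrite -(ps m).
apply: (hR0 (fun m => X (p m))) => [|g y /hR hy]; first exact: (zclosed_preim pD).
exact: hX hy.
Qed.

Context (H : Grp) (T : seq H) (c : G -> H) (N' N : ZGmod H).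

(** For each basis element [x] of the free module, [phi (p (basis x))] is near [c x.1] and has a
    filling near [c x.1] with uniform radius. Chosen fillings are extended additively, without
    equivariance, and composed with [s]. *)
Lemma controlled_lift (A : geom S M) (B' : geom T N') (B : geom T N)
    (d : hom N' N) (phi : M -> N) :
  free_retract M -> coarse S T c -> addm phi -> controlled c A B phi ->
  (forall m, exists y, d y = phi m) ->
  exists psi : M -> N', [/\ addm psi, controlled c A B' psi & forall m, d (psi m) = phi m].
Proof.
case=> k [s [p ps]] coarse_c phiD phiC phi_im.
(* Radius 0 suffices, since a basis element [x] sits exactly at [x.1]. *)
have [R1 hR1] := hom_controlled (F k) A p 0.
have [R2 hR2] := phiC R1.
have [R3 hR3] := controlled_filling B' B d R2.
have hv (x : free_gset G 'I_k) :
    exists y, near B' R3 (c x.1) y /\ d y = phi (p (basis x)).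
  have [|y hy dy] := hR3 (c x.1) (phi (p (basis x))) _ (phi_im _).
    by apply/hR2/hR1/near_basis; apply: dist_le_refl.
  by exists y.
have {hv} [v hv] := choice hv.
exists (fun m => ext v (s m)); split.
- by move=> x y; rewrite hadd extD.
(* The basis elements occurring in [s m] lie within [R'] of [g], so their fillings, centred at
   points within [D] of [c g], are near [c g]. *)
- move=> R; have [R' hR'] := hom_controlled A (F k) s R.
  have [D hD] := coarse_c R'; exists (R3 + D)%N => g m /hR'/near_supp hm.
  apply: ext_supp => [|x /hm gx]; first exact: near_z.
  apply: near_shift (proj1 (hv x)); apply: dist_le_sym; exact: hD.
move=> m; rewrite -[in RHS](ps m).
apply: (additive_eq (f := fun m => d (ext v m)) (g := fun m => phi (p m))).
- by move=> x y; rewrite extD hadd.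
- by move=> x y; rewrite hadd phiD.
by move=> x; rewrite ext_basis (proj2 (hv x)).
Qed.

End Retract.

(** * Comparison of augmented complexes *)

(** [cyc] is a field because no differential leaves degree 0, where the cycles will be the kernel of
    the augmentation; [cycP] expresses exactness. *)
Record aug_complex (G : Grp) := AugComplex {
  cM : nat -> ZGmod G;
  cd : forall i, hom (cM i.+1) (cM i);
  cyc : forall i, cM i -> Prop;
  cycP : forall i m, @cyc i m <-> exists y, cd i y = m;
  cycS : forall i m, @cyc i.+1 m <-> cd i m = 0
}.

Lemma cyc_gclosed (G : Grp) (E : aug_complex G) i : gclosed (@cyc _ E i).
Proof.
have dD := @hadd _ _ _ (cd E i); split; first split.
- by apply/cycP; exists 0; rewrite addm0.
- by move=> x y /cycP[u <-] /cycP[v <-]; apply/cycP; exists (u + v).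
- by move=> x /cycP[u <-]; apply/cycP; exists (- u); rewrite addmN.
by move=> g x /cycP[u <-]; apply/cycP; exists (mact g u); rewrite hequiv.
Qed.

Section Compare.
Context (G H : Grp) (S : seq G) (T : seq H).
Context (gS : generates S) (gT : generates T).
Context (c : G -> H) (c' : H -> G) (C : nat).
Context (coarse_c : coarse S T c) (coarse_c' : coarse T S c').
Context (close_c : forall g, dist_le S (c' (c g)) g C).
Context (E : aug_complex G) (F : aug_complex H).

(* [f] and [r] are the degree-[k] parts of chain maps lying over the
   quasi-retraction, [t = id - r f - h d] for a chain homotopy [h]. *)
Definition comparison k : Prop :=
  exists (A : geom S (cM E k)) (B : geom T (cM F k))
    (f : cM E k -> cM F k) (r : cM F k -> cM E k) (t : cM E k -> cM E k),
    [/\ [/\ addm f, addm r & addm t],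
        [/\ controlled c A B f, controlled c' B A r & controlled id A A t],
        [/\ forall m, cyc m -> cyc (f m), forall m, cyc m -> cyc (r m) &
            forall m, cyc (t m)],
        forall m, cyc m -> t m = m - r (f m) &
        (forall m, t m = 0) \/ free_retract (cM E k)].

(** The maps [f'], [r'] and [h] lift [f d], [r d] and [t] through the differentials. With
    [t' = id - r' f' - h d] one gets [d t' = d - r f d - t d], which is 0 because [t = id - r f] on
    cycles. *)
Lemma comparison_step k : comparison k ->
  free_retract (cM E k.+1) -> free_retract (cM F k.+1) -> comparison k.+1.
Proof.
case=> A [B [f [r [t [[fD rD tD] [fC rC tC] [fZ rZ tZ] tE t_lift]]]]] prE prF.
have [A' _] := retract_geom gS prE; have [B' _] := retract_geom gT prF.
have dE := hom_controlled A' A (cd E k); have dF := hom_controlled B' B (cd F k).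
have dED := @hadd _ _ _ (cd E k); have dFD := @hadd _ _ _ (cd F k).
have cycE m : cyc (cd E k m) by apply/cycP; exists m.
have cycF m : cyc (cd F k m) by apply/cycP; exists m.
have [f' [f'D f'C f'E]] : exists f' : cM E k.+1 -> cM F k.+1,
    [/\ addm f', controlled c A' B' f' & forall m, cd F k (f' m) = f (cd E k m)].
  apply: (@controlled_lift _ _ gS _ _ _ c _ _ A' B' B (cd F k) (f \o cd E k)) => //.
  - exact: addm_comp.
  - exact: (controlled_comp dE fC).
  by move=> m; apply/cycP/fZ.
have [r' [r'D r'C r'E]] : exists r' : cM F k.+1 -> cM E k.+1,
    [/\ addm r', controlled c' B' A' r' & forall m, cd E k (r' m) = r (cd F k m)].
  apply: (@controlled_lift _ _ gT _ _ _ c' _ _ B' A' A (cd E k) (r \o cd F k)) => //.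
  - exact: addm_comp.
  - exact: (controlled_comp dF rC).
  by move=> m; apply/cycP/rZ.
have [h [hD hC hE]] : exists h : cM E k -> cM E k.+1,
    [/\ addm h, controlled id A A' h & forall m, cd E k (h m) = t m].
  case: t_lift => [t0|prEk].
    exists (fun _ => 0); split=> [x y|R|m]; rewrite ?addr0 ?t0 ?addm0 //.
    by exists 0%N => g m _; case: (near_z A' 0 g).
  apply: (@controlled_lift _ _ gS _ _ _ id _ _ A A' A (cd E k) t) => //.
    by move=> D; exists D.
  by move=> m; apply/cycP.
pose t' m := m - r' (f' m) - h (cd E k m).
exists A', B', f', r', t'; split.
- split=> //; apply: addm_sub; last exact: (addm_comp hD dED).
  by apply: addm_sub => //; apply: (addm_comp r'D f'D).
- split=> //; apply: controlled_sub; last exact: (controlled_comp dE hC).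
  apply: controlled_sub; first by move=> R; exists R.
  exact: (controlled_close close_c (controlled_comp f'C r'C)).
- split=> [m /cycS dm|m /cycS dm|m]; apply/cycS.
  + by rewrite f'E dm addm0.
  + by rewrite r'E dm addm0.
  by rewrite /t' !(addmB dED) r'E f'E hE tE // subrr.
- by move=> m /cycS dm; rewrite /t' dm (addm0 hD) subr0.
by right.
Qed.

(** Write a cycle [m] as [t m + r (d w)]. As [t] and [r \o d] are controlled and take only cycles as
    values, decomposing [m] and [w] into pieces of bounded support turns both summands into sums of
    cycles of bounded support. *)
Lemma comparison_fin_gen k : comparison k -> free_retract (cM F k.+1) ->
  fin_gen (@cyc _ E k).
Proof.
case=> A [B [f [r [t [[fD rD tD] [fC rC tC] [fZ rZ tZ] tE _]]]]] prF.
have [B' _] := retract_geom gT prF.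
have [R0 hR0] := near_gen B'.
have [R1 hR1] := controlled_comp (hom_controlled B' B (cd F k)) rC R0.
have [R2 hR2] := near_gen A; have [R3 hR3] := tC R2.
have [cycZ cycG] := cyc_gclosed E k.
(* One radius for both summands: [R3] bounds the values of [t], and [R1] those of [r \o d]. *)
have [xs hxs] := near_fin A (R1 + R3).
have [ys ysP hys] := zspan_noetherian
  (zclosed_and (near_z A (R1 + R3) (gone G)) cycZ) (fun m hm => hxs m (proj1 hm)).
have [ysZ ysG] := gclosed_gspan (fun y => y \in ys).
have near_gspan g m : near A (R1 + R3) g m -> cyc m -> gspan (fun y => y \in ys) m.
  move=> hm cm; rewrite -(mactVK g m); apply: ysG.
  have hs : zspan ys (mact (ginv g) m).
    by apply: hys; split; [apply: near_translate|apply: cycG].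
  by move=> X gX hX; apply: hs; [case: gX|].
exists ys => m; split=> [cm|]; last first.
  by apply; [split|move=> y /ysP[]].
rewrite -(subrK (r (f m)) m) -tE //; case: (ysZ) => _ ysD _; apply: ysD.
  apply: (hR2 (fun m => gspan (fun y => y \in ys) (t m))).
    exact: (zclosed_preim tD ysZ).
  move=> g y /hR3 hy; apply: near_gspan (tZ y); apply: near_mono hy.
  exact: leq_addl.
have /cycP[w <-] := fZ m cm.
apply: (hR0 (fun w => gspan (fun y => y \in ys) (r (cd F k w)))).
  exact: (zclosed_preim (addm_comp rD (@hadd _ _ _ (cd F k))) ysZ).
move=> h y /hR1 hy; apply: near_gspan.
  by apply: near_mono hy; apply: leq_addr.
by apply/rZ/cycP; exists y.
Qed.

End Compare.

(** * The permutation module of a group pair *)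

Section Cosets.
Context (G : Grp) (P : gpair G).
Implicit Types (A B : coset P) (g x : G).

(** Extensionality identifies the predicates and proof irrelevance the [c_ok] fields; the indices
    must agree because the family may contain repetitions. *)
Lemma coset_eq A B : c_idx A = c_idx B -> (forall x, c_set A x <-> c_set B x) -> A = B.
Proof.
case: A B => [i X hX] [j Y hY] /= ij XY; case: j / ij hY => hY.
have {}XY : X = Y by apply/funext => x; apply/propext.
by case: Y / XY hY => hY; rewrite (Prop_irrelevance hX hY).
Qed.

Lemma coset_transl_set g A :
  exists h, forall x, c_set A (gmul (ginv g) x) <-> exists p, @pfam G P (c_idx A) p /\ x = gmul h p.
Proof.
have [a ha] := c_ok A; exists (gmul g a) => x; rewrite ha.
split=> -[p [Pp e]]; exists p; split=> //; first by rewrite -gmulA -e gmulVK.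
by rewrite e -gmulA gmulK.
Qed.

Definition coset_act g A : coset P :=
  Build_coset (coset_transl_set g A).

Lemma coset_act1 A : coset_act (gone G) A = A.
Proof. by apply: coset_eq => //= x; rewrite ginv1 gmul1. Qed.

Lemma coset_actM g h A : coset_act (gmul g h) A = coset_act g (coset_act h A).
Proof. by apply: coset_eq => //= x; rewrite ginvM gmulA. Qed.

Definition coset_gset : Gset G := Build_Gset coset_act1 coset_actM.

Lemma coset_actKV g A : coset_act g (coset_act (ginv g) A) = A.
Proof. by rewrite -coset_actM gmulrV coset_act1. Qed.

Lemma coset_translP g A B : coset_transl g A B <-> B = coset_act g A.
Proof.
split=> [[e hB]|->]; last by split.
by apply: coset_eq => // x; rewrite hB.
Qed.

Lemma coset_mem A : exists a, c_set A a.
Proof.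
have [a ha] := c_ok A; exists a; apply/ha; exists (gone G).
by split; [apply: sg_one|rewrite gmulr1].
Qed.

Definition mk_coset (i : 'I_(pk P)) g : coset P :=
  @Build_coset G P i (fun x => exists p, @pfam G P i p /\ x = gmul g p)
    (ex_intro _ g (fun x => iff_refl _)).

(** Needed for local finiteness: the cosets meeting a ball are represented by elements of that
    ball. *)
Lemma mk_coset_mem A a : c_set A a -> A = mk_coset (c_idx A) a.
Proof.
have [g hg] := c_ok A; move=> /hg[q [Pq ->]].
apply: coset_eq => //= x; rewrite hg; split=> -[p [Pp ->]].
  exists (gmul (ginv q) p); rewrite -gmulA gmulVK; split=> //.
  by apply: sg_mul => //; apply: sg_inv.
by exists (gmul q p); rewrite gmulA; split=> //; apply: sg_mul.
Qed.

(** A coset is near [g] when it meets the ball about [g]. An infinite coset is thus near points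
    arbitrarily far apart, which is harmless: only finitely many cosets are near a given point. *)
Definition coset_geom (S : seq G) (gS : generates S) : gset_geom S coset_gset.
Proof.
exists (fun R g A => exists2 a, c_set A a & dist_le S g a R).
- move=> R g h A [a Aa ha]; exists (gmul g a); last exact/dist_le_mull.
  by rewrite /= gmulK.
- move=> R D g h A gh [a Aa ga]; exists a => //; rewrite addnC.
  exact: dist_le_trans (dist_le_sym gh) ga.
- move=> R; have [B hB] := ball_finite S R.
  exists (List.map (fun ia => mk_coset ia.1 ia.2) (List.list_prod (enum 'I_(pk P)) B)).
  move=> A [a Aa ha]; rewrite (mk_coset_mem Aa).
  apply: (List.in_map (fun ia => mk_coset ia.1 ia.2) _ (_, _)).
  apply: List.in_prod; first by apply/In_mem; rewrite mem_enum.
  by apply: hB; move: ha; rewrite /dist_le ginv1 gmul1.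
- move=> A; have [a Aa] := coset_mem A.
  by have [R hR] := gen_dist gS (gone G) a; exists R, a.
exists 0%N => A; have [a Aa] := coset_mem A; exists a, a => //.
exact: dist_le_refl.
Defined.

Definition coset_mod : ZGmod G := perm_mod coset_gset.

Definition aug : coset_mod -> int := ext (fun _ : coset P => 1 : int).

Lemma augD : addm aug. Proof. exact: extD. Qed.

Lemma coef_sum_NoDup (f : coset P -> int) s : List.NoDup s ->
  forall A, coef (\sum_(B <- s) basis B *~ f B) A = if `[< List.In A s >] then f A else 0.
Proof.
move=> + A; elim: s => [_|B s IH /List.NoDup_cons_iff[Bs /IH{}IH]].
  by rewrite big_nil coef0; case: asboolP.
rewrite big_cons coefD IH coefMz coef_basis.
case: eqP => [BA|BA]; last first.
  rewrite mul0rz add0r; congr (if _ then _ else _); apply/asboolP/asboolP => [|[]//].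
  by right.
have -> : B = A := BA; rewrite intz; move: Bs; have -> : B = A := BA => As.
case: asboolP => // _; case: asboolP => [_|[]]; rewrite ?addr0 //; by left.
Qed.

Lemma foldr_sum (f : coset P -> int) s :
  foldr (fun A acc => f A + acc) 0 s = \sum_(A <- s) f A.
Proof. by elim: s => [|A s IH] /=; rewrite ?big_nil // big_cons IH. Qed.

(** A duplicate-free list containing the support of [f] turns it into a finite sum of basis
    elements; conversely the support of [m] is such a list. *)
Lemma in_DeltaP (f : coset P -> int) :
  in_Delta f <-> exists2 m : coset_mod, aug m = 0 & forall A, coef m A = f A.
Proof.
split=> [[s [s_uniq [s_supp s_sum]]]|[m m0 mf]].
  exists (\sum_(B <- s) basis B *~ f B).
    rewrite (addm_sum augD) -[RHS]s_sum foldr_sum; apply: eq_bigr => A _.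
    by rewrite (addmMz augD) /aug ext_basis intz.
  move=> A; rewrite coef_sum_NoDup //; case: asboolP => // As.
  by have [//|/eqP/s_supp] := eqVneq (f A) 0.
exists (msupp m : seq _); split.
  have : uniq (msupp m) by [].
  elim: (msupp m : seq _) => [_|A s IH /= /andP[As /IH h]]; constructor=> //.
  by move/In_mem; apply/negP.
split=> [A fA|].
  by apply/(@In_mem {classic coset P}); rewrite -mcoeff_neq0; apply/eqP; rewrite -/(coef m A) mf.
rewrite -[RHS]m0 foldr_sum /aug /ext; apply: eq_bigr => A _.
by rewrite intz mf.
Qed.

End Cosets.

(** * Resolutions *)

(** Moves the augmentation from functions on cosets to a homomorphism into [coset_mod P]. An element
    is determined by its coefficients, so the chosen preimages are automatically additive and
    equivariant in [x]. *)
Lemma FPnP (G : Grp) (P : gpair G) n : FPn P n <->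
  exists (Pm : nat -> ZGmod G) (d : forall i, hom (Pm i.+1) (Pm i))
    (eps : hom (Pm 0%N) (coset_mod P)),
    [/\ forall m, aug m = 0 <-> exists y, eps y = m,
        forall x, eps x = 0 <-> exists y, d 0%N y = x,
        forall i (x : Pm i.+1), d i x = 0 <-> exists y, d i.+1 y = x,
        forall i, projective (Pm i) &
        forall i, (i < n)%N -> fg_mod (Pm i)].
Proof.
split=> -[Pm [d [eps]]].
  case=> [epsD [epsE [eps_im [eps_surj [eps_ker [d_ker [pr fg]]]]]]].
  have lift x : exists m : coset_mod P, aug m = 0 /\ forall A, coef m A = eps x A.
    by have [m] := (in_DeltaP (eps x)).1 (eps_im x); exists m.
  have [e he] := choice lift.
  have eE x A : coef (e x) A = eps x A by case: (he x).
  have eD : addm e by move=> x y; apply: coefP => A; rewrite coefD !eE epsD.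
  have eG g x : e (mact g x) = mact g (e x).
    apply: coefP => A; rewrite -[A](coset_actKV g) (coef_mact (X := coset_gset P)) !eE.
    exact/epsE/coset_translP.
  exists Pm, d, (Build_hom eD eG); split=> // [m|x].
    split=> [m0|[x <-]]; last by case: (he x).
    have [|x hx] := eps_surj (coef m); first by apply/in_DeltaP; exists m.
    by exists x; apply: coefP => A; rewrite eE hx.
  rewrite -eps_ker /=; split=> [e0|e0].
    by apply/funext => A; rewrite -eE e0 coef0.
  by apply: coefP => A; rewrite eE e0 coef0.
case=> eps_im eps_ker d_ker pr fg.
exists Pm, d, (fun x => coef (eps x)); split; [|split; [|split; [|split; [|split]]]] => //.
- by move=> x y A; rewrite hadd coefD.
- by move=> g x A B /coset_translP->; rewrite hequiv coef_mact.
- by move=> x; apply/in_DeltaP; exists (eps x) => //; apply/eps_im; exists x.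
- move=> f /in_DeltaP[m /eps_im[x <-] hm]; exists x; exact/funext.
move=> x; rewrite -eps_ker; split=> [e|->].
  by apply: coefP => A; rewrite coef0 e.
by apply/funext => A; rewrite coef0.
Qed.

(** * Free resolutions, finitely generated wherever possible *)

Section Resolution.
Context (G : Grp).

Record stage := Stage {
  sM : ZGmod G;
  sK : sM -> Prop;
  sK_closed : gclosed sK
}.

(** [cI_fin] is conditional, so that the resolution can be defined before any of its cycles are
    known to be finitely generated. *)
Record cover (s : stage) := Cover {
  cI : Type;
  cgen : cI -> sM s;
  cgen_in : forall i, sK (cgen i);
  cgen_span : forall m, sK m -> gspan (fun x => exists i, x = cgen i) m;
  cI_fin : fin_gen (@sK s) -> exists k, cI = 'I_k
}.

(** By excluded middle: a finite generating family if there is one, otherwise all elements of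
    [sK]. *)
Definition stage_cover (s : stage) : cover s.
Proof.
have [fgK|nfgK] := pselect (fin_gen (@sK s)).
  have [xs hxs] := cid fgK.
  apply: (@Cover s 'I_(size xs) (tnth (in_tuple xs))).
  - by move=> i; apply/hxs => X _; apply; apply: mem_tnth.
  - move=> m /hxs hm X gX hX; apply: hm => // x /seq_tnthP[i ->].
    by apply: hX; exists i.
  by exists (size xs).
apply: (@Cover s {m | sK m} (@proj1_sig _ _)) => [[]//|m Km X _|//].
by apply; exists (exist _ m Km).
Qed.

Definition bd (s : stage) : hom (free_mod G (cI (stage_cover s))) (sM s) :=
  free_lift (@cgen _ (stage_cover s)).

Definition next_stage (s : stage) : stage := Stage (hom_ker_gclosed (bd s)).

Lemma bd_im (s : stage) (m : sM s) : sK m <-> exists y, bd s y = m.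
Proof.
split=> [/(@cgen_span _ (stage_cover s)) h|[y <-]].
  apply: (h (fun m => exists y, bd s y = m)) => [|x [i ->]]; last by exists (free_gen _ i); rewrite free_lift_gen.
  have bD := @hadd _ _ _ (bd s); split; first split.
  - by exists 0; rewrite addm0.
  - by move=> _ _ [u <-] [v <-]; exists (u + v).
  - by move=> _ [u <-]; exists (- u); rewrite addmN.
  by move=> g _ [u <-]; exists (mact g u); rewrite hequiv.
apply: (free_gspan (hom_gclosed (bd s) (sK_closed s))) => i.
by rewrite free_lift_gen; apply: cgen_in.
Qed.

Lemma bd_fg (s : stage) : fin_gen (@sK s) -> fg_mod (sM (next_stage s)).
Proof.
by move=> /(cI_fin (stage_cover s))[k eI] /=; rewrite eI; apply: free_fg_mod.
Qed.

Definition resolution (s : stage) : aug_complex G :=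
  @AugComplex G (fun i => sM (iter i next_stage s)) (fun i => bd (iter i next_stage s))
    (fun i => @sK (iter i next_stage s)) (fun i => @bd_im (iter i next_stage s))
    (fun i m => iff_refl _).

Section Augment.
Context (M0 : ZGmod G) (K0 : M0 -> Prop) (Pm : nat -> ZGmod G).
Context (d : forall i, hom (Pm i.+1) (Pm i)) (eps : hom (Pm 0%N) M0).
Context (eps_im : forall m, K0 m <-> exists y, eps y = m).
Context (eps_ker : forall x, eps x = 0 <-> exists y, d 0%N y = x).
Context (d_ker : forall i (x : Pm i.+1), d i x = 0 <-> exists y, d i.+1 y = x).

Let M i := if i is j.+1 then Pm j else M0.

Let dM i : hom (M i.+1) (M i) :=
  match i return hom (M i.+1) (M i) with 0 => eps | j.+1 => d j end.

Let K i : M i -> Prop :=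
  match i return M i -> Prop with 0 => K0 | j.+1 => fun m => dM j m = 0 end.

Let K_im i m : @K i m <-> exists y, dM i y = m.
Proof. by case: i m => [|[|i]]; [apply: eps_im|apply: eps_ker|apply: d_ker]. Qed.

Definition augment : aug_complex G :=
  @AugComplex G M dM K K_im (fun i m => iff_refl _).

End Augment.

End Resolution.

(** * Quasi-retractions *)

Lemma lipschitz_coarse (G H : Grp) (S : seq G) (T : seq H) L C (f : G -> H) :
  lipschitz S T L C f -> coarse S T f.
Proof. by move=> hf D; exists (L * D + C)%N => x y; apply: hf. Qed.

Section PushForward.
Context (G H : Grp) (S : seq G) (T : seq H) (gS : generates S) (gT : generates T).
Context (P : gpair G) (Q : gpair H).

Definition push (f : coset P -> coset Q) : coset_mod P -> coset_mod Q :=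
  ext (fun A => basis (f A)).

(** If [a] in [A] is within [R] of [g], then [f1 a] is within [L * R + C] of [f1 g], and [f2 A] has
    a point within [M] of [f1 a]. *)
Lemma push_controlled L C M f1 f2 : lipschitz_pair S T L C M f1 f2 ->
  controlled f1 (perm_geom (coset_geom P gS)) (perm_geom (coset_geom Q gT)) (push f2).
Proof.
case=> f1_lip f2_near R; exists (L * R + C + M)%N => g m /near_supp hm.
apply: ext_supp => [|A /hm[a Aa ga]]; first exact: near_z.
apply: near_basis; have [h _] := f2_near A.
have [|b [Bb [n [nM ab]]]] := h (f1 a); first by exists a.
exists b => //; apply: dist_le_trans (f1_lip _ _ _ ga) _.
exact: dist_le_mono (ltnW nM) ab.
Qed.

Lemma aug_push f m : aug (push f m) = aug m.
Proof.
apply: (additive_eq (f := fun m => aug (push f m)) (g := @aug _ P)) => [x y|x y|A].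
- by rewrite /push extD augD.
- exact: augD.
by rewrite /push ext_basis /aug !ext_basis.
Qed.

End PushForward.

Lemma push_id (G H : Grp) (P : gpair G) (Q : gpair H) (f : coset P -> coset Q)
  (r : coset Q -> coset P) : (forall A, r (f A) = A) -> forall m, push r (push f m) = m.
Proof.
move=> rf; apply: (additive_eq (f := push r \o push f) (g := id)) => // [x y|A].
  by rewrite /push /= !extD.
by rewrite /push /= !ext_basis rf.
Qed.

Theorem theorem4p6 (G H : Grp) (SG : seq G) (SH : seq H)
    (P : gpair G) (Q : gpair H) (n : nat) :
  generates SG -> generates SH -> (2 <= n)%N ->
  quasi_retract SG SH P Q -> FPn Q n -> FPn P n.
Proof.
move=> gSG gSH _ [L [C [M [f1 [f2 [r1 [r2 [_ [f_lip [r_lip [close rf]]]]]]]]]]].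
move=> /FPnP[Pm [d [eps [eps_im eps_ker d_ker pr fg]]]].
have augZ : gclosed (fun m : coset_mod P => aug m = 0).
  split; first split.
  - exact: addm0 (@augD _ P).
  - by move=> x y; rewrite augD => -> ->.
  - by move=> x; rewrite (addmN (@augD _ P)) => ->; rewrite oppr0.
  move=> g x x0; rewrite -[RHS]x0.
  apply: (additive_eq (f := fun m : coset_mod P => aug (mact g m)) (g := @aug _ P)).
  - by move=> u v; rewrite mact_add augD.
  - exact: augD.
  by move=> A; rewrite mact_basis /aug !ext_basis.
pose E := resolution (Stage augZ).
pose F := augment eps_im eps_ker d_ker.
(* [augment] shifts degrees by one: [cM F k.+1] is [Pm k]. *)
have F_retract k : (k < n)%N -> free_retract (cM F k.+1).
  by move=> kn; apply: fg_projective_retract; [apply: pr|apply: fg].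
have cf := lipschitz_coarse f_lip.1; have cr := lipschitz_coarse r_lip.1.
(* Comparison and finiteness climb together: a comparison in degree [k] makes the [k]-cycles of [E]
   finitely generated, hence [cM E k.+1] a finitely generated free module, as the next comparison
   requires. *)
have cmp k : (k <= n)%N -> comparison SG SH f1 r1 E F k.
  elim: k => [_|k IH kn].
    (* In degree 0 the maps push cosets forward along [f2] and [r2]; since [r2 \o f2] is the
       identity, [t = 0]. *)
    exists (perm_geom (coset_geom P gSG)), (perm_geom (coset_geom Q gSH)).
    exists (push f2), (push r2), (fun _ => 0); split.
    - by split=> [||x y]; [apply: extD|apply: extD|rewrite addr0].
    - split; [exact: push_controlled f_lip|exact: push_controlled r_lip|move=> R].
      by exists 0%N => g m _; case: (near_z (perm_geom (coset_geom P gSG)) 0 g).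
    - split=> [m|m|_]; [exact: etrans (aug_push f2 m)|exact: etrans (aug_push r2 m)|].
      exact: addm0 (@augD _ P).
    - by move=> m _; rewrite push_id // subrr.
    by left.
  have {}IH := IH (ltnW kn).
  apply: (comparison_step gSG gSH cf cr close IH); last exact: F_retract.
  apply: fg_projective_retract; first exact: free_projective.
  exact: bd_fg (comparison_fin_gen gSH IH (F_retract k kn)).
(* Dropping degree 0 from [E] leaves the resolution, with [cd E 0] as its augmentation. *)
apply/FPnP; exists (fun i => cM E i.+1), (fun i => cd E i.+1), (cd E 0); split.
- exact: (@cycP _ E 0).
- exact: (@cycP _ E 1).
- by move=> i; apply: (@cycP _ E i.+2).
- by move=> i; apply: free_projective.
move=> i ltin.
exact: bd_fg (comparison_fin_gen gSH (cmp i (ltnW ltin)) (F_retract i ltin)).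
Qed.
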